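(* For every nontrivial connected graph $G$, $\alpha_{bn}(G) < 2\alpha(G)$, where $\alpha(G)$ is the independence number of $G$.
   Context: A broadcast on a nontrivial connected graph $G$ is a function $f:V(G)\to\{0,1,\dots,\operatorname{diam}(G)\}$ with $f(v)\le e(v)$ (the eccentricity of $v$) for every $v$. Let $V_f^+=\{v: f(v)>0\}$ (broadcasting vertices). A vertex $u$ hears $f$ from $v\in V_f^+$ if $d_G(u,v)\le f(v)$; $N_f(v)$ is the set of vertices hearing $f$ from $v$ (including $v$), $PN_f(v)$ is the set of vertices hearing $f$ only from $v$, and $B_f(v)=\{u\in N_f(v): d_G(u,v)=f(v)\}$. The broadcast $f$ is boundary independent (bn-independent) if $N_f(v)\setminus B_f(v)\subseteq PN_f(v)$ for all $v\in V_f^+$. The cost of $f$ is $\sigma(f)=\sum_{v}f(v)$, and $\alpha_{bn}(G)$ is the maximum cost of a boundary independent broadcast on $G$. *)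

(* Defs.v *)
From mathcomp Require Import all_boot.

Set Implicit Arguments.
Unset Strict Implicit.
Unset Printing Implicit Defensive.

(* A finite simple graph is a symmetric irreflexive adjacency relation [e] on
   a finite type [T] of vertices. *)
Definition simple_graph (T : finType) (e : rel T) : Prop :=
  symmetric e /\ irreflexive e.

Definition connected_graph (T : finType) (e : rel T) : Prop :=
  forall u v : T, connect e u v.

Definition nontrivial_graph (T : finType) (e : rel T) : Prop := 1 < #|T|.

Section GraphParameters.
Variables (T : finType) (e : rel T).

Definition has_walk (n : nat) (u v : T) : bool :=
  [exists p : n.-tuple T, path e u p && (last u p == v)].

(* A shortest walk repeats no vertex, so its length is below [#|T|]; the value
   [#|T|] is only taken on pairs that no walk joins. *)
Definition dist (u v : T) : nat :=
  \big[minn/#|T|]_(n < #|T| | has_walk n u v) n.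

Definition ecc (v : T) : nat := \max_(u : T) dist v u.

Definition diam : nat := \max_(v : T) ecc v.

Definition independent (S : {set T}) : bool :=
  [forall x in S, forall y in S, ~~ e x y].

Definition alpha : nat := \max_(S : {set T} | independent S) #|S|.

Section Broadcast.
Variable f : {ffun T -> 'I_diam.+1}.

Definition is_broadcast : bool := [forall v, f v <= ecc v].

Definition broadcasting : {set T} := [set v | 0 < f v].

(* The sets below are meant for [v \in broadcasting]. *)
Definition hearers (v : T) : {set T} := [set u | dist u v <= f v].

Definition private_hearers (v : T) : {set T} :=
  [set u in hearers v |
    [forall w in broadcasting, (u \in hearers w) ==> (w == v)]].

Definition boundary (v : T) : {set T} :=
  [set u in hearers v | dist u v == f v].

Definition bn_independent : bool :=
  [forall v in broadcasting,
    hearers v :\: boundary v \subset private_hearers v].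

Definition cost : nat := \sum_(v : T) f v.

End Broadcast.

Definition alpha_bn : nat :=
  \max_(f : {ffun T -> 'I_diam.+1} | is_broadcast f && bn_independent f) cost f.

End GraphParameters.

(* Main.v *)
Require Import Defs.
From mathcomp Require Import all_boot.
From mathcomp Require Import zify.

Set Implicit Arguments.
Unset Strict Implicit.
Unset Printing Implicit Defensive.

(** If [v] and [w] are distinct broadcasting vertices of a bn-independent
    broadcast [f], then [f v + f w <= d(v, w)].  Around every [w] choose one
    vertex in each even layer below [f w]: vertices in layers of the same centre
    are at distance at least 2 because their layers are, and vertices around
    distinct centres because the centres are far apart.  This independent set
    has [uphalf (f w)] vertices around [w], which gives [2 * alpha >= cost].
    The inequality is strict if some [f v] is odd; if all values are even, the
    layer [f v] itself can be added for a single broadcasting vertex [v]. *)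

Lemma has_walkP (T : finType) (e : rel T) n u v :
  reflect (exists p, [/\ path e u p, last u p = v & size p = n])
          (has_walk e n u v).
Proof.
apply: (iffP existsP) => [[p /andP[pP /eqP pv]]|[p [pP pv /eqP pn]]].
  by exists p; rewrite size_tuple.
by exists (Tuple pn); rewrite /= pP pv eqxx.
Qed.

Section Distance.
Variables (T : finType) (e : rel T).

Lemma dist_max u v : dist e u v <= #|T|.
Proof.
rewrite /dist; elim/big_ind: _ => // [x y le_x _|i _]; last exact: ltnW.
by rewrite geq_min le_x.
Qed.

Lemma dist_le_walk n u v : has_walk e n u v -> dist e u v <= n.
Proof.
(* Walks of length at least [#|T|] are not indexed by the minimum; for them the cap [#|T|]
   suffices. *)
move=> w; have [ltn|len] := ltnP n #|T|; last exact: leq_trans (dist_max u v) _.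
rewrite /dist; elim: (index_enum _) (mem_index_enum (Ordinal ltn)) => //= i r IHr.
rewrite inE big_cons => /predU1P[<-|/IHr le_r]; first by rewrite w geq_minl.
by case: ifP => // _; rewrite geq_min le_r orbT.
Qed.

Lemma dist_refl u : dist e u u = 0.
Proof.
by apply/eqP; rewrite -leqn0; apply/dist_le_walk/has_walkP; exists [::].
Qed.

Lemma dist_edge u v : e u v -> dist e u v <= 1.
Proof.
by move=> euv; apply/dist_le_walk/has_walkP; exists [:: v]; rewrite /= euv.
Qed.

Hypothesis connected_e : connected_graph e.

Lemma dist_walk u v : has_walk e (dist e u v) u v.
Proof.
have /connectP[p0 p0P ->] := connected_e u v.
case/shortenP: p0P => p pP p_uniq _ {p0}.
have lt_p : size p < #|T| by rewrite -[_.+1](card_uniqP p_uniq) max_card.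
have wp : has_walk e (size p) u (last u p) by apply/has_walkP; exists p.
(* The guard [< #|T|] makes the induction over the minimum vacuous at its default value [#|T|]. *)
suff: dist e u (last u p) < #|T| -> has_walk e (dist e u (last u p)) u (last u p).
  by apply; apply: leq_ltn_trans (dist_le_walk wp) lt_p.
rewrite /dist.
elim/big_ind: _ => [|x y IHx IHy|i] //; first by rewrite ltnn.
by rewrite /minn; case: ifP.
Qed.

Lemma dist_triangle u v w : dist e u w <= dist e u v + dist e v w.
Proof.
have /has_walkP[p [pP pv <-]] := dist_walk u v.
have /has_walkP[q [qP qw <-]] := dist_walk v w.
apply/dist_le_walk/has_walkP; exists (p ++ q).
by rewrite cat_path last_cat size_cat pv pP qP.
Qed.

Lemma dist_sym : symmetric e -> commutative (dist e).
Proof.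
move=> sym_e; suff le u v : dist e u v <= dist e v u.
  by move=> u v; apply/eqP; rewrite eqn_leq !le.
have /has_walkP[p [pP pu <-]] := dist_walk v u.
apply/dist_le_walk/has_walkP; exists (rev (belast v p)); split.
- by rewrite -pu rev_path (eq_path (e' := e)) // => x y; rewrite sym_e.
- by case: p pu {pP} => [|x p] //= _; rewrite rev_cons last_rcons.
- by rewrite size_rev size_belast.
Qed.

(** Cut a shortest walk after [k] steps: its two pieces bound both distances from above, and the
    triangle inequality forces equality. *)
Lemma dist_between u w k : k <= dist e u w ->
  exists2 x, dist e u x = k & dist e x w = dist e u w - k.
Proof.
move=> le_k; have /has_walkP[p [pP pw pn]] := dist_walk u w.
move: pP pw; rewrite -{1 2}(cat_take_drop k p) cat_path last_cat.
set x := last u _ => /andP[tP dP] xw.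
have le1 : dist e u x <= k.
  by apply/dist_le_walk/has_walkP; exists (take k p); rewrite size_takel ?pn.
have le2 : dist e x w <= dist e u w - k.
  by apply/dist_le_walk/has_walkP; exists (drop k p); rewrite size_drop pn.
by have := dist_triangle u x w; exists x; lia.
Qed.

Lemma layer_nonempty u k : k <= ecc e u -> exists x, dist e u x == k.
Proof.
have [w ->] : {w | ecc e u = dist e u w}.
  by apply: eq_bigmax; apply/card_gt0P; exists u.
by case/dist_between=> x <- _; exists x.
Qed.

(** Otherwise some vertex of a shortest walk from [v] to [w] lies strictly inside the ball of [v],
    hence is private to [v], and yet hears [w]. *)
Lemma bn_independent_dist (f : {ffun T -> 'I_(diam e).+1}) v w :
  symmetric e -> bn_independent f -> 0 < f v -> 0 < f w -> v != w ->
  f v + f w <= dist e v w.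
Proof.
move=> sym_e /forall_inP bn fv fw; apply: contraNleq => lt_d.
(* The last non-boundary layer of [v] on the walk, or [w] itself if the walk ends before that
   layer. *)
have [|x vx xw] := @dist_between v w (minn (f v).-1 (dist e v w)).
  exact: geq_minr.
have /bn/subsetP/(_ x) : v \in broadcasting f by rewrite inE.
rewrite !inE (dist_sym sym_e x v) vx.
case/(_ _)/andP; first by lia.
move=> _ /forall_inP/(_ w); rewrite !inE eq_sym => /(_ fw)/implyP; apply.
by rewrite xw; lia.
Qed.

End Distance.

Lemma independent_le_alpha (T : finType) (e : rel T) (S : {set T}) :
  independent e S -> #|S| <= alpha e.
Proof. by move=> indS; rewrite /alpha (bigD1 S) //= leq_maxl. Qed.

Lemma alpha_gt0 (T : finType) (e : rel T) :
  irreflexive e -> 0 < #|T| -> 0 < alpha e.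
Proof.
move=> irr_e /card_gt0P[x _]; rewrite -(cards1 x); apply: independent_le_alpha.
by apply/forall_inP=> y /set1P->; apply/forall_inP=> z /set1P->; rewrite irr_e.
Qed.

Lemma card_ord_double_lt N m : m <= N ->
  #|[set i : 'I_N | i.*2 < m]| = uphalf m.
Proof.
move=> le_m; have le_u : uphalf m <= N by lia.
rewrite -sum1_card (eq_bigl (fun i : 'I_N => i < uphalf m)) => [|i].
  by rewrite -(big_ord_widen N (fun=> 1) le_u) sum1_card card_ord.
by rewrite inE; lia.
Qed.

Lemma cost_lt_alpha (T : finType) (e : rel T) (f : {ffun T -> 'I_(diam e).+1}) :
  simple_graph e -> connected_graph e -> 0 < #|T| ->
  is_broadcast f -> bn_independent f -> cost f < 2 * alpha e.
Proof.
move=> [sym_e irr_e] conn_e T_gt0 /forallP f_ecc bn_f.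
have symd := dist_sym conn_e sym_e; have tri := dist_triangle conn_e.
have [f0|f_neq0] := boolP [forall v, f v == 0 :> nat].
  rewrite /cost big1 => [|v _]; first by rewrite muln_gt0 alpha_gt0.
  by apply/eqP/(forallP f0).
have [v fv v_odd] : exists2 v, 0 < f v & odd (f v) \/ forall w, ~~ odd (f w).
  have [/existsP[v odd_v]|/existsPn no_odd] := boolP [exists v, odd (f v)].
    by exists v; [apply: odd_gt0 | left].
  by have /forallPn[v] := f_neq0; rewrite -lt0n => fv; exists v => //; right.
(* Layers [2i < m w] are used around [w]. The extra 1 at [v] admits the layer [f v] exactly when
   [f v] is even, and makes the total [cost f + 1]. *)
pose m w := f w + (w == v).
(* The default [p.1] is never reached on [D], where the layers are nonempty. *)
pose g (p : T * 'I_(diam e).+2) := odflt p.1 [pick x | dist e p.1 x == p.2.*2].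
pose D := [set p : T * 'I_(diam e).+2 | p.2.*2 < m p.1].
have D_le (p : T * 'I_(diam e).+2) : p \in D -> p.2.*2 <= f p.1.
  by rewrite inE /m; case: (_ == v); lia.
have gE (p : T * 'I_(diam e).+2) : p \in D -> dist e p.1 (g p) = p.2.*2.
  move/D_le=> le_p; rewrite /g; case: pickP => [x /eqP//|no_x].
  have [x] := layer_nonempty conn_e (leq_trans le_p (f_ecc p.1)).
  by rewrite no_x.
have D_pos (p : T * 'I_(diam e).+2) : p \in D -> 0 < f p.1.
  by rewrite inE /m; case: eqP => [->|_] //; lia.
have g_far (p q : T * 'I_(diam e).+2) :
    p \in D -> q \in D -> p != q -> 1 < dist e (g p) (g q).
  move=> pD qD neq_pq; have := gE p pD; have := gE q qD.
  have [eq1|neq1] := eqVneq p.1 q.1.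
    have neq2 : p.2 != q.2 :> nat.
      apply: contra neq_pq => /eqP/val_inj eq2.
      by rewrite [p]surjective_pairing eq1 eq2 -surjective_pairing.
    rewrite eq1; have := tri q.1 (g p) (g q); have := tri q.1 (g q) (g p).
    by rewrite (symd (g q) (g p)); lia.
  (* The two chosen layers must fall short of [f p.1 + f q.1] by at least 2 in total. If [f v] is
     odd, each centre contributes at least 1; if all values are even, a centre other than [v]
     contributes 2. *)
  have := bn_independent_dist conn_e sym_e bn_f (D_pos p pD) (D_pos q qD) neq1.
  have := tri p.1 (g p) q.1; have := tri (g p) (g q) q.1.
  rewrite (symd (g q) q.1); move: pD qD; rewrite !inE /m.
  case: v_odd => [odd_v|even].
    by case: eqP => [->|_]; case: eqP => [->|_]; lia.
  have := even p.1; have := even q.1.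
  by case: (p.1 =P v) neq1 => [->|_]; case: (q.1 =P v) => [->|_]; rewrite ?eqxx //; lia.
have g_inj : {in D &, injective g}.
  move=> p q pD qD eq_g; apply/eqP/negPn/negP => /(g_far _ _ pD qD).
  by rewrite eq_g dist_refl.
have indep : independent e (g @: D).
  apply/forall_inP=> _ /imsetP[p pD ->]; apply/forall_inP=> _ /imsetP[q qD ->].
  have [->|neq_pq] := eqVneq p q; first by rewrite irr_e.
  by apply: contraL (g_far _ _ pD qD neq_pq) => /dist_edge; rewrite -leqNgt.
have cardD : #|D| = \sum_w uphalf (m w).
  transitivity (\sum_w \sum_(i < (diam e).+2 | i.*2 < m w) 1).
    by rewrite pair_big_dep /= -sum1_card; apply: eq_bigl => p; rewrite inE.
  apply: eq_bigr => w _; rewrite -(@card_ord_double_lt (diam e).+2).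
    by rewrite -sum1_card; apply: eq_bigl => i; rewrite inE.
  by rewrite /m; have := ltn_ord (f w); lia.
have cost_m : \sum_w m w = (cost f).+1.
  rewrite big_split /= -[RHS]addn1; congr (_ + _).
  by rewrite (bigD1 v) //= eqxx big1 // => w /negbTE->.
rewrite -cost_m; apply: leq_trans (_ : 2 * #|g @: D| <= _); last first.
  by rewrite leq_mul2l independent_le_alpha.
rewrite card_in_imset // cardD big_distrr; apply: leq_sum => w _ /=; lia.
Qed.

Theorem theorem3p1 (T : finType) (e : rel T)
    (simple_e : simple_graph e) (connected_e : connected_graph e)
    (nontrivial_e : nontrivial_graph e) :
  alpha_bn e < 2 * alpha e.
Proof.
have T_gt0 : 0 < #|T| := ltnW nontrivial_e.
have pos : 0 < 2 * alpha e by rewrite muln_gt0 alpha_gt0 //; case: simple_e.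
(* The strict bound becomes a non-strict one by the predecessor, so that it can be checked on each
   broadcast. *)
rewrite -(prednK pos) ltnS; apply/bigmax_leqP => f /andP[f_ecc bn_f].
by rewrite -ltnS (prednK pos) cost_lt_alpha.
Qed.
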